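(* Let $0\le r\le 1$. The finite-system stationary current $J_L(r)$ is monotone nonincreasing in $L$, that is, $J_{L+1}(r)\le J_L(r)$ for every integer $L\ge1$. Moreover, for every integer $L\ge 1$, $J_L(r)$ is an upper bound for the current of the infinite system: every stationary probability measure $\mu$ of the totally asymmetric simple exclusion process on $\mathbb{Z}$ with a blockage of rate $r$ at the bond $(0,1)$ has current $J(\mu)\le J_L(r)$. In particular, if $J_L(r)<1/4$ for some $L$, then no stationary measure of the infinite system has current in the interval $(J_L(r),1/4]$.
   Context: Finite open system: for an integer $L\ge1$ and $r\ge0$, consider the continuous-time Markov chain on configurations $\eta=(\eta(-L+1),\dots,\eta(L))\in\{0,1\}^{2L}$ ($\eta(k)=1$: site $k$ occupied; $\eta(k)=0$: empty) with transitions: (i) if $\eta(-L+1)=0$, a particle is added at site $-L+1$ at rate $1$; (ii) for each $i\in\{-L+1,\dots,L-1\}$ with $i\ne0$, if $\eta(i)=1$ and $\eta(i+1)=0$, the particle at $i$ jumps to $i+1$ at rate $1$; (iii) if $\eta(0)=1$ and $\eta(1)=0$, the particle at $0$ jumps to $1$ at rate $r$; (iv) if $\eta(L)=1$, the particle at $L$ is removed at rate $1$. This chain has a unique stationary distribution, and $J_L(r)=r\,\Pr(\eta(0)=1,\eta(1)=0)$ in it (the stationary expected rate of particle passage across any bond). Infinite system: the Markov (Feller) process on $\{0,1\}^{\mathbb{Z}}$ in which, for each $i\ne0$, a particle at $i$ jumps to $i+1$ at rate $1$ if $i+1$ is empty, and a particle at $0$ jumps to $1$ at rate $r$ if $1$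 is empty. For a stationary probability measure $\mu$ of this process, its current is $J(\mu)=r\,\mu(\eta(0)=1,\eta(1)=0)$, which equals $\mu(\eta(i)=1,\eta(i+1)=0)$ for every $i\neq0$. *)

(* Defs.v *)
From HB Require Import structures.
From mathcomp Require Import all_boot all_order all_algebra.
From mathcomp Require Import all_classical all_reals all_analysis.

Set Implicit Arguments.
Unset Strict Implicit.
Unset Printing Implicit Defensive.

Import Order.TTheory GRing.Theory Num.Theory.
Import numFieldNormedType.Exports.

Local Open Scope classical_set_scope.
Local Open Scope ring_scope.

Definition bond_rate (R : realType) (r : R) (i : int) : R :=
  if i == 0 then r else 1.

(** * The finite open system *)

(* The sites -L+1, ..., L are encoded by 'I_(2L): [site i] is the label of the
   i-th site from the left. *)
Definition site (L : nat) (i : 'I_L.*2) : int := i%:Z - L%:Z + 1.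

Definition fconfig (L : nat) := {ffun 'I_L.*2 -> bool}.

(* [occupied eta k]: the site labelled k belongs to the system and carries a
   particle. *)
Definition occupied (L : nat) (eta : fconfig L) (k : int) : bool :=
  [exists i : 'I_L.*2, (site i == k) && eta i].

(* Transition rate from eta to zeta (off-diagonal entries of the Q-matrix; every
   transition changes the configuration, so the value is 0 if zeta = eta). *)
Definition frate (R : realType) (r : R) (L : nat) (eta zeta : fconfig L) : R :=
    \sum_(i < L.*2 | site i == 1 - L%:Z)
       (~~ eta i && (zeta == [ffun k => [eta eta with i |-> true] k]))%:R
  + \sum_(i < L.*2) \sum_(j < L.*2 | site j == site i + 1)
       bond_rate r (site i) *
       [&& eta i, ~~ eta j
         & zeta == [ffun k => [eta eta with i |-> false, j |-> true] k]]%:R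
  + \sum_(i < L.*2 | site i == L%:Z)
       (eta i && (zeta == [ffun k => [eta eta with i |-> false] k]))%:R.

Definition fstationary (R : realType) (r : R) (L : nat)
    (p : {ffun fconfig L -> R}) : Prop :=
  [/\ forall eta, 0 <= p eta,
      \sum_eta p eta = 1
    & forall zeta, \sum_eta p eta * frate r eta zeta
                   = p zeta * \sum_eta frate r zeta eta].

(* The stationary distribution of the finite chain, which exists and is unique
   for L >= 1 and r >= 0. *)
Definition fstationary_dist (R : realType) (r : R) (L : nat) :
    {ffun fconfig L -> R} :=
  xget 0 [set p | fstationary r p].

Definition fcurrent (R : realType) (r : R) (L : nat) : R :=
  r * \sum_(eta : fconfig L | occupied eta 0 && ~~ occupied eta 1)
        fstationary_dist r L eta.

(** * The infinite system *)

(* {0,1}^Z with the product sigma-algebra, which is also the Borel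
   sigma-algebra of the product topology. *)
Definition coordinate_sets : set (set (int -> bool)) :=
  [set A | exists (k : int) (b : bool), A = [set eta | eta k = b]].

Notation config := (g_sigma_algebraType coordinate_sets).

Definition cylinder (R : realType) (f : (int -> bool) -> R) : Prop :=
  exists s : seq int, forall eta zeta : int -> bool,
    {in s, eta =1 zeta} -> f eta = f zeta.

(* The formal generator. For cylinder f only finitely many terms are nonzero, so
   the finitely supported sum over Z is the genuine one. *)
Definition tasep_generator (R : realType) (r : R) (f : (int -> bool) -> R)
    (eta : int -> bool) : R :=
  \sum_(i \in [set: int])
     bond_rate r i * (eta i && ~~ eta (i + 1))%:R *
     (f [eta eta with i |-> false, i + 1 |-> true] - f eta).

Definition kernel_op (R : realType) (P : R -> R.-pker config ~> config)
    (t : R) (f : (int -> bool) -> R) (eta : int -> bool) : R :=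
  Rintegral (P t eta) setT f.

(* P is the transition function P_t(eta, A) (t >= 0) of the infinite system: a
   Feller transition function on the compact space {0,1}^Z whose infinitesimal
   generator extends [tasep_generator] on cylinder functions. Since the rates
   are bounded and of finite range, cylinder functions form a core, so that
   these conditions determine P_t for all t >= 0. *)
Record tasep_process (R : realType) (r : R)
    (P : R -> R.-pker config ~> config) : Prop := TasepProcess {
  tasep_start : forall (eta : config) (A : set config),
    measurable A -> P 0 eta A = \d_eta A;
  tasep_chapman_kolmogorov :
    forall (s t : R) (eta : config) (A : set config),
    0 <= s -> 0 <= t -> measurable A ->
    P (s + t) eta A = (\int[P s eta]_zeta P t zeta A)%E;
  tasep_feller : forall (t : R) (f : {ptws int -> bool} -> R),
    0 <= t -> continuous f ->
    continuous (kernel_op P t f : {ptws int -> bool} -> R);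
  tasep_strongly_continuous : forall f : {ptws int -> bool} -> R,
    continuous f -> forall e : R, 0 < e ->
    \forall t \near 0^'+, forall eta : int -> bool,
      `|kernel_op P t f eta - f eta| < e;
  tasep_infinitesimal : forall f : (int -> bool) -> R,
    cylinder f -> forall e : R, 0 < e ->
    \forall t \near 0^'+, forall eta : int -> bool,
      `|(kernel_op P t f eta - f eta) / t - tasep_generator r f eta| < e
}.

Definition stationary (R : realType) (P : R -> R.-pker config ~> config)
    (mu : probability config R) : Prop :=
  forall (t : R) (A : set config), 0 <= t -> measurable A ->
    (\int[mu]_eta P t eta A)%E = mu A.

Definition current (R : realType) (r : R) (mu : probability config R) : R :=
  r * fine (mu [set eta : config | eta 0 && ~~ eta 1]).

(* Main.v *)
Require Import Defs.
From HB Require Import structures.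
From mathcomp Require Import all_boot all_order all_algebra.
From mathcomp Require Import all_classical all_reals all_analysis.
From mathcomp Require Import measurable_realfun zify ring lra.

(* Let V_n(eta) be the expected number of crossings of the bond (0, 1) during n
   steps of the uniformized finite chain started from eta. In terms of height
   functions the dynamics is attractive, so V_n increases when a particle is
   added at the left end or removed at the right end, and the oscillation of V_n
   is bounded uniformly in n. The generator of a larger system (2L + 2 sites, or
   Z) acts on functions of the inner 2L sites as the generator of the open system
   with some of the entrances and exits suppressed; by monotonicity, applied to
   V_n it is at most the finite generator. Hence the mean of V_n under a
   stationary law of the larger system grows at least at the rate of its own
   current, while under the stationary law of the open system it grows exactly at
   the rate J_L; boundedness of the oscillation then gives the comparison of the
   currents. *)

Set Implicit Arguments.
Unset Strict Implicit.
Unset Printing Implicit Defensive.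

Import Order.TTheory GRing.Theory Num.Theory.
Import numFieldNormedType.Exports.

Local Open Scope ring_scope.

(** * Height functions *)

(** No exclusion test is made here. Seen from the window - L + 1, ..., L, the bond - L fills the
    first site and the bond L empties the last one, so entrance, jump and exit share one form. *)
Definition move (b : int) (eta : int -> bool) : int -> bool :=
  [eta eta with b |-> false, b + 1 |-> true].

Lemma moveE b eta k :
  move b eta k = if k == b then false else if k == b + 1 then true else eta k.
Proof. by []. Qed.

(* The bond (k, k + 1) is labelled k; the extreme bonds - L and L are the entrance
   and the exit of the finite system. *)
Definition bond (L : nat) (j : 'I_L.*2.+1) : int := j%:Z - L%:Z.

(** Reservoir convention: whatever [eta] says there, the site - L counts as occupied and the site L
    + 1 as empty. *)
Definition unblocked (L : nat) (b : int) (eta : int -> bool) : bool :=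
  ((b == - L%:Z) || eta b) && ((b == L%:Z) || ~~ eta (b + 1)).

Definition in_window (L : nat) (k : int) : bool := (- L%:Z < k) && (k <= L%:Z).

Definition local_on (R : realType) (L : nat) (f : (int -> bool) -> R) : Prop :=
  forall eta zeta : int -> bool,
    (forall k, in_window L k -> eta k = zeta k) -> f eta = f zeta.

(** Heights are fixed only up to an additive constant; this freedom lets them record past
    crossings. *)
Definition is_height (L : nat) (eta : int -> bool) (h : int -> int) : Prop :=
  forall k, in_window L k -> h (k - 1) - h k = (eta k : nat)%:Z.

(* Meaningful only for - L <= k, because of the absolute value. *)
Definition height (L : nat) (eta : int -> bool) (k : int) : int :=
  - (\sum_(i < `|(k + L%:Z)%R|%N) (eta (i%:Z - L%:Z + 1) : nat)%:Z).

Lemma height_is_height L eta : is_height L eta (height L eta).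
Proof.
move=> k /andP[k1 k2]; rewrite /height.
have -> : `|(k + L%:Z)%R|%N = `|(k - 1 + L%:Z)%R|%N.+1 by lia.
rewrite big_ord_recr /=.
have -> : (`|(k - 1 + L%:Z)%R|%N%:Z - L%:Z + 1) = k by lia.
by rewrite opprK addrA addNr add0r.
Qed.

Lemma height_bounds L eta k : - L%:Z <= k <= L%:Z ->
  - (L.*2%:Z) <= height L eta k <= 0.
Proof.
move=> /andP[k1 k2]; rewrite /height.
set m := `|(k + L%:Z)%R|%N.
have m2 : (m <= L.*2)%N by rewrite /m; lia.
rewrite oppr_le0 sumr_ge0 ?andbT // lerN2.
apply: (@le_trans _ _ (\sum_(i < m) 1)).
  by apply: ler_sum => i _; case: (eta _).
by rewrite sumr_const card_ord natz lez_nat.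
Qed.

(** * Expected number of crossings *)

Section Chain.
Variables (R : realType) (r : R).

Definition generator (L : nat) (f : (int -> bool) -> R) (eta : int -> bool) : R :=
  \sum_(j < L.*2.+1) bond_rate r (bond j) * (unblocked L (bond j) eta)%:R *
     (f (move (bond j) eta) - f eta).

(** The same 2L + 1 bonds as in [generator], but the extreme ones consult the actual sites - L and L
    + 1. *)
Definition bulk_generator (L : nat) (f : (int -> bool) -> R) (eta : int -> bool) : R :=
  \sum_(j < L.*2.+1) bond_rate r (bond j) *
     (eta (bond j) && ~~ eta (bond j + 1))%:R *
     (f (move (bond j) eta) - f eta).

Definition flux (eta : int -> bool) : R := r * (eta 0 && ~~ eta 1)%:R.

(* Expected number of crossings of the bond (0, 1) during the first n steps of
   the chain that at each step rings one of the 2L + 1 bonds uniformly. *)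
Fixpoint crossings (L n : nat) (eta : int -> bool) : R :=
  if n is n'.+1 then
    crossings L n' eta + (L.*2.+1)%:R^-1 *
      (generator L (crossings L n') eta + flux eta)
  else 0.

(** The flux becomes a unit reward for crossing the bond 0, which for L > 0 is not extreme, so that
    [unblocked] is the exclusion rule there. *)
Lemma generator_flux L f eta : (0 < L)%N ->
  generator L f eta + flux eta =
  \sum_(j < L.*2.+1) bond_rate r (bond j) * (unblocked L (bond j) eta)%:R *
     (f (move (bond j) eta) - f eta + (bond j == 0)%:R).
Proof.
move=> L0; rewrite /generator.
under [RHS]eq_bigr do rewrite mulrDr.
rewrite big_split /=; congr (_ + _).
have LL : (L < L.*2.+1)%N by lia.
have bL : bond (Ordinal LL) = 0 by rewrite /bond /= subrr.
rewrite (bigD1 (Ordinal LL)) //= bL eqxx mulr1 big1 ?addr0.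
  rewrite /flux /bond_rate /unblocked eqxx.
  have -> : (0 == - L%:Z) = false by lia.
  by have -> : (0 == L%:Z) = false by lia.
move=> j jL.
have -> : (bond j == 0) = false.
  apply/negbTE; apply: contraNN jL => /eqP j0; apply/eqP/val_inj => /=.
  by move: j0; rewrite /bond; lia.
by rewrite mulr0.
Qed.

Hypotheses (r0 : 0 <= r) (r1 : r <= 1).

Lemma bond_rate_ge0 b : 0 <= bond_rate r b.
Proof. by rewrite /bond_rate; case: ifP. Qed.

Lemma bond_rate_le1 b : bond_rate r b <= 1.
Proof. by rewrite /bond_rate; case: ifP. Qed.

(** Raising the height at b alone by one lowers the difference at b and raises the one at b + 1:
    exactly a jump across b. *)
Lemma is_height_move L b eta h : unblocked L b eta -> is_height L eta h ->
  is_height L (move b eta) (fun k => h k + (k == b : nat)%:Z).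
Proof.
move=> /andP[bl br] H k wk; have := H k wk; move: wk; rewrite /in_window moveE.
have [->|kb] := eqVneq k b.
  move=> wk; have -> : (b - 1 == b) = false by lia.
  have -> : eta b = true by move: bl; case: (eta b) => //; rewrite orbF; lia.
  by move=> /=; lia.
have [->|kb1] := eqVneq k (b + 1).
  move=> wk; rewrite addrK eqxx.
  have -> : eta (b + 1) = false
    by move: br; case: (eta (b + 1)) => //; rewrite orbF; lia.
  by move=> /=; lia.
have -> : (k - 1 == b) = false by lia.
by move=> /= wk <-; lia.
Qed.

(* The height at 0 counts the past crossings of the bond (0, 1); the two chains are
   coupled by ringing the same bond. *)
Lemma crossings_mono L n eta eta' h h' : (0 < L)%N ->
  is_height L eta h -> is_height L eta' h' ->
  (forall k, - L%:Z <= k <= L%:Z -> h k <= h' k) ->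
  crossings L n eta + (h 0)%:~R <= crossings L n eta' + (h' 0)%:~R.
Proof.
move=> L0; elim: n eta eta' h h' => [|n IH] eta eta' h h' H H' hh'.
  by rewrite /= !add0r ler_int; apply: hh'; lia.
rewrite /= !generator_flux //.
have q0 : 0 < (L.*2.+1)%:R :> R by rewrite ltr0n.
(* Multiplying by the number of bonds gives each bond one copy of the current value; the comparison
   is then made bond by bond. *)
have spl x y : (L.*2.+1)%:R * (x + y) = \sum_(j < L.*2.+1) x + (L.*2.+1)%:R * y.
  by rewrite mulrDr sumr_const card_ord mulr_natl.
rewrite -(ler_pM2l q0) 2!(addrAC _ _ (_ %:~R)) !spl !mulVKf ?gt_eqF //.
rewrite -!big_split /=; apply: ler_sum => j _.
set b := bond j.
have wb : - L%:Z <= b <= L%:Z by have := ltn_ord j; rewrite /b /bond; lia.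
have c0 := bond_rate_ge0 b; have c1 := bond_rate_le1 b.
(* A ring of b is accepted with probability [bond_rate r b], at most 1, so the step is a convex
   combination of staying and trying the move. *)
have E (z : int -> bool) (g : int -> int) :
    crossings L n z + (g 0)%:~R + bond_rate r b * (unblocked L b z)%:R *
      (crossings L n (move b z) - crossings L n z + (b == 0)%:R) =
    (1 - bond_rate r b) * (crossings L n z + (g 0)%:~R) +
    bond_rate r b *
    (crossings L n (if unblocked L b z then move b z else z) +
     (g 0 + (unblocked L b z && (0 == b) : nat)%:Z)%:~R).
  rewrite intrD eq_sym; case: (unblocked L b z) => /=; case: (0 == b) => /=; ring.
rewrite !E; apply: lerD.
  by rewrite ler_wpM2l ?subr_ge0 //; exact: IH.
rewrite ler_wpM2l //.
pose up (z : int -> bool) (g : int -> int) k := g k + (unblocked L b z && (k == b) : nat)%:Z.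
have upH (z : int -> bool) g : is_height L z g ->
    is_height L (if unblocked L b z then move b z else z) (up z g).
  rewrite /up; case: ifP => o Hz; first exact: is_height_move.
  by move=> k wk; rewrite /= !addr0; exact: Hz.
apply: (IH _ _ (up eta h) (up eta' h')); try exact: upH.
move=> k wk; rewrite /up; have := hh' k wk.
have [kb|] := eqVneq k b; last by rewrite !andbF !addr0.
(* If h b < h' b, a rise by one keeps the order. If h b = h' b, the order at b - 1 and b + 1 gives
   eta b <= eta' b and eta' (b + 1) <= eta (b + 1), so b is unblocked in eta' whenever it is in
   eta. *)
rewrite kb !andbT => {k wk kb} hb; have hb1 := hh' (b - 1); have hb2 := hh' (b + 1).
have Hb := H b; have Hb' := H' b; have Hb1 := H (b + 1); have Hb1' := H' (b + 1).
move: hb1 hb2 Hb Hb' Hb1 Hb1'; rewrite /in_window /unblocked addrK.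
case: (eta b); case: (eta (b + 1)); case: (eta' b); case: (eta' (b + 1)) => /=;
  rewrite ?andbF ?andbT ?orbT ?orbF /=; lia.
Qed.

(** Configurations that agree on the window share a height function; monotonicity applies both
    ways. *)
Lemma crossings_local L n : (0 < L)%N -> local_on L (crossings L n).
Proof.
move=> L0 eta zeta ez.
have H := @height_is_height L eta.
have H' : is_height L zeta (height L eta) by move=> k wk; rewrite -ez ?H.
by apply/le_anti/andP; split; rewrite -(lerD2r (height L eta 0)%:~R);
   exact: crossings_mono.
Qed.

(** A move across b != 0 raises the heights without changing the one at 0. It serves for the
    entrance and the exit. *)
Lemma crossings_le_move L n b eta : (0 < L)%N -> b != 0 -> unblocked L b eta ->
  crossings L n eta <= crossings L n (move b eta).
Proof.
move=> L0 b0 ob; have H := @height_is_height L eta.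
rewrite -(lerD2r (height L eta 0)%:~R).
have h0 : height L eta 0 = height L eta 0 + (0 == b : nat)%:Z.
  by rewrite eq_sym (negbTE b0) addr0.
rewrite {2}h0.
apply: (@crossings_mono L n eta (move b eta) (height L eta) (fun k => height L eta k + (k == b : nat)%:Z)) => //.
  exact: is_height_move.
by move=> k _; rewrite lerDl.
Qed.

(** Normalized heights lie in [- 2L, 0] on the window, so the height of [zeta] raised by 2L
    dominates that of [eta]; at 0 the two then differ by at most 4L, whatever n is. *)
Lemma crossings_osc L n eta zeta : (0 < L)%N ->
  crossings L n eta <= crossings L n zeta + L.*2.*2%:R.
Proof.
move=> L0; pose h k := height L zeta k + L.*2%:Z.
have Hh : is_height L zeta h.
  by move=> k wk; rewrite -(@height_is_height L zeta k wk) /h; lia.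
have := @crossings_mono L n eta zeta (height L eta) h L0 (@height_is_height L eta) Hh.
have wle k : - L%:Z <= k <= L%:Z -> height L eta k <= h k.
  by move=> wk; have := height_bounds eta wk; have := height_bounds zeta wk; rewrite /h; lia.
move=> /(_ wle); have w0 : - L%:Z <= 0 <= L%:Z by lia.
have : h 0 - height L eta 0 <= L.*2.*2%:Z.
  have := height_bounds eta w0; have := height_bounds zeta w0; rewrite /h.
  move: (height L eta 0) (height L zeta 0) => x y; clear; lia.
rewrite -(ler_int R) intrB -[L.*2.*2%:~R]pmulrn; lra.
Qed.

(** Every bond open under exclusion is unblocked, and the extra terms of [generator] are nonnegative
    by [crossings_le_move]. *)
Lemma generator_ge_bulk L n eta : (0 < L)%N ->
  bulk_generator L (crossings L n) eta <= generator L (crossings L n) eta.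
Proof.
move=> L0; apply: ler_sum => j _; set b := bond j.
rewrite -!mulrA ler_wpM2l ?bond_rate_ge0 //.
have [ob|nob] := boolP (unblocked L b eta); last first.
  suff -> : eta b && ~~ eta (b + 1) = false by rewrite !mul0r.
  by apply: contraNF nob => /andP[e1 e2]; rewrite /unblocked e1 e2 !orbT.
(* [crossings_le_move] excludes b = 0, but there the two rules coincide. *)
have [b0|b0] := eqVneq b 0.
  rewrite le_eqVlt; apply/orP; left; move: ob; rewrite /unblocked b0.
  have -> : (0 == - L%:Z) = false by lia.
  have -> : (0 == L%:Z) = false by lia.
  by move=> /= ->.
have D : 0 <= crossings L n (move b eta) - crossings L n eta.
  by rewrite subr_ge0 crossings_le_move.
by case: (eta b && _); rewrite ?mul1r ?mul0r.
Qed.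

(* p is the law of a larger system seen from the window, where all the bonds of the
   window, including the extreme ones, follow the exclusion rule. *)
Lemma flux_le_of_stationary L (S T : finType) (p : S -> R) (s : S -> int -> bool)
    (q : T -> R) (t : T -> int -> bool) : (0 < L)%N ->
  (forall i, 0 <= p i) -> \sum_i p i = 1 -> (forall i, 0 <= q i) -> \sum_i q i = 1 ->
  (forall f, local_on L f -> \sum_i p i * bulk_generator L f (s i) = 0) ->
  (forall f, local_on L f -> \sum_i q i * generator L f (t i) = 0) ->
  \sum_i p i * flux (s i) <= \sum_i q i * flux (t i).
Proof.
move=> L0 p0 p1 q0 q1 ps qs.
set Jp := \sum_i p i * _; set Jq := \sum_i q i * _.
have c0 : 0 < (L.*2.+1)%:R^-1 :> R by rewrite invr_gt0 ltr0n.
set c := (L.*2.+1)%:R^-1 in c0.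
have Ep n : n%:R * (c * Jp) <= \sum_i p i * crossings L n (s i).
  elim: n => [|n IH]; first by rewrite mul0r big1 // => i _; rewrite mulr0.
  rewrite -natr1 mulrDl mul1r /=.
  under [leRHS]eq_bigr do rewrite mulrDr.
  rewrite big_split lerD //= -/c.
  under [leRHS]eq_bigr do rewrite mulrCA.
  rewrite -mulr_sumr ler_wpM2l ?(ltW c0) //.
  under [leRHS]eq_bigr do rewrite mulrDr.
  rewrite big_split /= lerDr.
  rewrite -[leLHS](ps _ (crossings_local n L0)).
  by apply: ler_sum => i _; rewrite ler_wpM2l ?p0 ?generator_ge_bulk.
have Eq n : \sum_i q i * crossings L n (t i) = n%:R * (c * Jq).
  elim: n => [|n IH]; first by rewrite mul0r big1 // => i _; rewrite mulr0.
  rewrite -natr1 mulrDl mul1r /= -IH.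
  under eq_bigr do rewrite mulrDr.
  rewrite big_split /= -/c; congr (_ + _).
  under eq_bigr do rewrite mulrCA.
  rewrite -mulr_sumr; congr (_ * _).
  under eq_bigr do rewrite mulrDr.
  by rewrite big_split /= (qs _ (crossings_local n L0)) add0r.
have avg (I : finType) (w : I -> R) x : \sum_i w i = 1 -> \sum_i w i * x = x.
  by move=> w1; rewrite -mulr_suml w1 mul1r.
(* Both means average values of the same function, so they differ by at most its oscillation. *)
have osc n : n%:R * (c * Jp) <= n%:R * (c * Jq) + L.*2.*2%:R.
  apply: (le_trans (Ep n)); rewrite -Eq.
  have le_t j : \sum_i p i * crossings L n (s i) <= crossings L n (t j) + L.*2.*2%:R.
    rewrite -[leRHS](avg _ _ _ p1); apply: ler_sum => i _.
    by rewrite ler_wpM2l ?p0 ?crossings_osc.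
  rewrite -[leLHS](avg _ _ _ q1) -[L.*2.*2%:R](avg _ _ _ q1) -big_split /=.
  by apply: ler_sum => j _; rewrite -mulrDr ler_wpM2l ?q0.
(* If Jp > Jq, the gap n c (Jp - Jq) exceeds 4L for large n. *)
rewrite leNgt; apply/negP => JJ.
have d0 : 0 < c * (Jp - Jq) by rewrite mulr_gt0 ?subr_gt0.
have /archi_boundP : 0 <= L.*2.*2%:R / (c * (Jp - Jq)) by rewrite divr_ge0 // ltW.
rewrite ltr_pdivrMr //; set n := Num.bound _.
by have := osc n; rewrite !mulrBr; lra.
Qed.

End Chain.

(** * The finite chain *)

(* The absolute value of a left null vector of the Q-matrix is subinvariant, hence
   invariant since its total mass is preserved. *)
Lemma exists_stationary (R : realFieldType) (T : finType) (t0 : T) (Q : T -> T -> R) :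
  (forall x y, 0 <= Q x y) ->
  exists p : {ffun T -> R}, [/\ forall x, 0 <= p x, \sum_x p x = 1
    & forall y, \sum_x p x * Q x y = p y * \sum_x Q y x].
Proof.
move=> Q0; pose out y := \sum_x Q y x.
(* The rows of M sum to zero (any diagonal term [Q x x] cancels), so M is singular and has a nonzero
   left null vector. *)
pose M : 'M[R]_#|T| := \matrix_(i, j)
  (Q (enum_val i) (enum_val j) - (i == j)%:R * out (enum_val i)).
have M1 : M *m const_mx 1 = 0 :> 'cV_#|T|.
  apply/matrixP => i k; rewrite !mxE.
  under eq_bigr do rewrite !mxE mulr1.
  rewrite sumrB [X in _ - X](bigD1 i) //= eqxx mul1r [X in _ - (_ + X)]big1.
    rewrite addr0 /out; apply/eqP; rewrite subr_eq0; apply/eqP.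
    rewrite (reindex (@enum_val T predT)) //=.
    by exists enum_rank => x _; rewrite ?enum_valK ?enum_rankK.
  by move=> j /negbTE ji; rewrite eq_sym ji mul0r.
have cM : kermx M != 0.
  rewrite kermx_eq0 row_free_unit; apply/negP => uM.
  have : const_mx 1 = 0 :> 'cV[R]_#|T| by rewrite -(mulKmx uM (const_mx 1)) M1 mulmx0.
  move/matrixP/(_ (enum_rank t0) 0); rewrite !mxE => /eqP; by rewrite oner_eq0.
pose v := nz_row (kermx M).
have v0 : v != 0 by rewrite nz_row_eq0.
have vM : v *m M = 0 by apply/sub_kermxP; exact: nz_row_sub.
pose w x := v 0 (enum_rank x).
have wE y : \sum_x w x * Q x y = w y * out y.
  have /matrixP/(_ 0 (enum_rank y)) := vM; rewrite !mxE.
  rewrite (reindex (@enum_rank T)) /=; last first.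
    by exists (@enum_val T predT) => x _; rewrite ?enum_valK ?enum_rankK.
  under eq_bigr do rewrite mxE !enum_rankK mulrBr.
  rewrite sumrB => /eqP; rewrite subr_eq0 => /eqP ->.
  rewrite (bigD1 y) //= eqxx mul1r big1 ?addr0 //.
  by move=> x /negbTE xy; rewrite (inj_eq enum_rank_inj) xy mul0r mulr0.
have le_abs y : `|w y| * out y <= \sum_x `|w x| * Q x y.
  rewrite -[out y]ger0_norm ?sumr_ge0 // -normrM -wE.
  apply: (le_trans (ler_norm_sum _ _ _)); apply: ler_sum => x _.
  by rewrite normrM (ger0_norm (Q0 _ _)).
have tot : \sum_y \sum_x `|w x| * Q x y = \sum_y `|w y| * out y.
  by rewrite exchange_big /=; apply: eq_bigr => x _; rewrite -mulr_sumr.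
have balance y : \sum_x `|w x| * Q x y = `|w y| * out y.
  apply/eqP; rewrite -subr_eq0; apply/eqP.
  have d0 z : true -> 0 <= \sum_x `|w x| * Q x z - `|w z| * out z.
    by rewrite subr_ge0.
  by apply: (psumr_eq0P d0) => //; rewrite sumrB tot subrr.
pose s := \sum_x `|w x|.
have s0 : 0 < s.
  rewrite lt_def sumr_ge0 // andbT; apply: contraNneq v0 => /eqP.
  rewrite psumr_eq0 // => /allP w0; apply/eqP/matrixP => i j; rewrite mxE ord1.
  have := w0 (enum_val j) (mem_index_enum _).
  by rewrite /w enum_valK normr_eq0 => /eqP.
exists [ffun x => `|w x| / s]; split.
- by move=> x; rewrite ffunE divr_ge0 // ltW.
- under eq_bigr do rewrite ffunE.
  by rewrite -mulr_suml divff // gt_eqF.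
- move=> y; under eq_bigr do rewrite ffunE mulrAC.
  by rewrite -mulr_suml balance ffunE mulrAC.
Qed.

Lemma site_inj L : injective (@site L).
Proof. by move=> i j; rewrite /site => e; apply/val_inj => /=; lia. Qed.

Lemma site_in_window L (i : 'I_L.*2) : in_window L (site i).
Proof. by have := ltn_ord i; rewrite /in_window /site; lia. Qed.

Lemma in_windowP L k : in_window L k -> exists i : 'I_L.*2, site i = k.
Proof.
move=> wk; have kL : (`|(k + L%:Z - 1)%R|%N < L.*2)%N.
  by move: wk; rewrite /in_window; lia.
by exists (Ordinal kL); move: wk; rewrite /in_window /site /=; lia.
Qed.

Lemma occupied_site L (eta : fconfig L) i : occupied eta (site i) = eta i.
Proof.
apply/existsP/idP => [[j /andP[/eqP /site_inj ->]]//|ei].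
by exists i; rewrite eqxx.
Qed.

Section FiniteChain.
Variables (R : realType) (r : R).

Lemma frate_ge0 L (eta zeta : fconfig L) : 0 <= r -> 0 <= frate r eta zeta.
Proof.
move=> r0; rewrite /frate !addr_ge0 ?sumr_ge0 // => i _.
by rewrite sumr_ge0 // => j _; rewrite mulr_ge0 // /bond_rate; case: ifP.
Qed.

(** Since a stationary law exists, [xget] returns one and not its default 0. *)
Lemma fstationary_distP L : 0 <= r -> fstationary r (fstationary_dist r L).
Proof.
move=> r0; have [p ps] := @exists_stationary R (fconfig L) [ffun => false] _
  (fun x y => @frate_ge0 L x y r0).
exact: (@xgetPex _ 0 [set p | fstationary r p]%classic (ex_intro _ p ps)).
Qed.

(** The balance equations, weighted by g and summed. *)
Lemma fstationary_generator L (p : {ffun fconfig L -> R}) (g : fconfig L -> R) :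
  fstationary r p ->
  \sum_eta p eta * (\sum_zeta frate r eta zeta * (g zeta - g eta)) = 0.
Proof.
move=> [_ _ pb].
under eq_bigr do (under eq_bigr do rewrite mulrBr); under eq_bigr do rewrite sumrB mulrBr.
rewrite sumrB; apply/eqP; rewrite subr_eq0; apply/eqP.
under eq_bigr do rewrite mulr_sumr.
rewrite exchange_big /=; apply: eq_bigr => zeta _.
under eq_bigr do rewrite mulrA.
by rewrite -!mulr_suml pb mulrA.
Qed.

Lemma local_on_occupied L (f : (int -> bool) -> R) (eta : fconfig L) xi : local_on L f ->
  (forall i, eta i = xi (site i)) -> f (occupied eta) = f xi.
Proof.
move=> lf ex; apply: lf => k /in_windowP[i <-].
by rewrite occupied_site.
Qed.

(** The entrance term of [frate] is the bond - L; every other bond is indexed by its left site, the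
    last site giving the exit. *)
Lemma frate_generator L (f : (int -> bool) -> R) (eta : fconfig L) : (0 < L)%N -> local_on L f ->
  \sum_zeta frate r eta zeta * (f (occupied zeta) - f (occupied eta)) =
  generator r L f (occupied eta).
Proof.
move=> L0 lf; set c := f (occupied eta).
(* The sum over target configurations collapses to the one reached, which matters only through the
   window. *)
have pick (b : bool) (z : fconfig L) xi : (b -> forall i, z i = xi (site i)) ->
    \sum_(zeta : fconfig L) (b && (zeta == z))%:R * (f (occupied zeta) - c) =
    b%:R * (f xi - c).
  case: b => zx; last by rewrite mul0r big1 // => y _; rewrite mul0r.
  rewrite (bigD1 z) //= eqxx big1 ?addr0 => [|y /negbTE ->]; last by rewrite mul0r.
  by rewrite (local_on_occupied lf (zx isT)).
have swap (I : finType) (P : pred I) (X : I -> fconfig L -> R) :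
    \sum_zeta (\sum_(i | P i) X i zeta) * (f (occupied zeta) - c) =
    \sum_(i | P i) \sum_zeta X i zeta * (f (occupied zeta) - c).
  by rewrite exchange_big; apply: eq_bigr => z _; rewrite mulr_suml.
rewrite /generator big_ord_recl /frate.
under eq_bigr do rewrite !mulrDl.
rewrite !big_split /= -addrA !swap; congr (_ + _).
  have L2 : (0 < L.*2)%N by lia.
  rewrite (big_pred1 (Ordinal L2)); last first.
    by move=> i; rewrite /= -(inj_eq val_inj) /site /=; lia.
  have e0 : bond (@ord0 L.*2) + 1 = site (Ordinal L2) by rewrite /bond /site.
  rewrite (pick _ _ (move (bond (@ord0 L.*2)) (occupied eta))); last first.
    move=> _ i; rewrite ffunE /= moveE e0 (inj_eq (@site_inj L)) occupied_site.
    by have -> : (site i == bond (@ord0 L.*2)) = false by rewrite /bond /site /=; lia.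
  rewrite /unblocked e0 occupied_site /bond_rate /bond /= sub0r eqxx /=.
  have -> : (- L%:Z == L%:Z) = false by lia.
  have -> : (- L%:Z == 0) = false by lia.
  by rewrite mul1r.
rewrite [X in _ + X]big_mkcond -big_split /=; apply: eq_bigr => i _.
have bs : bond (lift ord0 i) = site i by rewrite /bond /site /= /bump /=; lia.
rewrite bs swap /unblocked occupied_site.
have -> : (site i == - L%:Z) = false.
  by have := site_in_window i; rewrite /in_window; lia.
(* At the site L no right neighbour exists and only the exit term remains; elsewhere the exit term
   is absent and the right neighbour is unique. *)
rewrite /=; case: (eqVneq (site i) L%:Z) => iL.
  rewrite big_pred0 ?add0r; last first.
    by move=> j; have := site_in_window j; rewrite iL /in_window; lia.
  rewrite (pick _ _ (move (site i) (occupied eta))); last first.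
    move=> _ j; rewrite ffunE /= moveE (inj_eq (@site_inj L)) occupied_site.
    case: (eqVneq j i) => // _.
    by have := site_in_window j; rewrite iL /in_window; case: eqVneq => // ->; lia.
  rewrite andbT iL /bond_rate; have -> : (L%:Z == 0) = false by lia.
  by rewrite mul1r.
have /in_windowP[j ji] : in_window L (site i + 1).
  by have := site_in_window i; move: iL; rewrite /in_window; lia.
rewrite addr0 (big_pred1 j); last first.
  by move=> k; rewrite -ji (inj_eq (@site_inj L)).
rewrite -ji occupied_site.
under eq_bigr do rewrite andbA -mulrA.
rewrite -mulr_sumr (pick _ _ (move (site i) (occupied eta))) ?mulrA //.
move=> _ k; rewrite ffunE /= moveE -ji !(inj_eq (@site_inj L)) occupied_site //.
Qed.

Lemma fcurrent_flux L : (0 < L)%N ->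
  fcurrent r L = \sum_eta fstationary_dist r L eta * flux r (occupied eta).
Proof.
move=> L0; rewrite /fcurrent mulr_sumr big_mkcond /=; apply: eq_bigr => eta _.
by rewrite /flux; case: ifP => _; rewrite ?mulr1 ?mulr0 // mulrC.
Qed.

Lemma fstationary_local L (f : (int -> bool) -> R) : 0 <= r -> (0 < L)%N -> local_on L f ->
  \sum_eta fstationary_dist r L eta * generator r L f (occupied eta) = 0.
Proof.
move=> r0 L0 lf.
rewrite -[RHS](fstationary_generator (fun eta => f (occupied eta)) (fstationary_distP L r0)).
by apply: eq_bigr => eta _; rewrite frate_generator.
Qed.

(** * Comparison of the sizes L and L + 1 *)

Lemma move_outside L (f : (int -> bool) -> R) b eta : local_on L f -> ~~ in_window L b ->
  ~~ in_window L (b + 1) -> f (move b eta) = f eta.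
Proof.
move=> lf b0 b1; apply: lf => k wk; rewrite moveE.
by case: eqVneq wk b0 => [-> ->//|_]; case: eqVneq b1 => [<- /negbTE -> |].
Qed.

(** The extreme bonds of the larger system touch only sites outside the smaller window; its other
    bonds are - L, ..., L under plain exclusion. *)
Lemma generator_succ L (f : (int -> bool) -> R) eta : local_on L f ->
  generator r L.+1 f eta = bulk_generator r L f eta.
Proof.
move=> lf; rewrite /generator big_ord_recl (@big_ord_recr _ _ _ L.*2.+1) /=.
rewrite !(move_outside _ lf) ?subrr ?mulr0 ?add0r ?addr0;
  try by rewrite /in_window /bond /= ?/bump /=; lia.
apply: eq_bigr => j _; have jL := ltn_ord j.
have -> : @bond L.+1 (lift ord0 (widen_ord (leqnSn _) j)) = bond j.
  by rewrite /bond /= /bump /=; lia.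
by rewrite /unblocked; congr (_ * _%:R * _); rewrite /bond /=; lia.
Qed.

Lemma fcurrent_succ L : 0 <= r -> r <= 1 -> (0 < L)%N ->
  fcurrent r L.+1 <= fcurrent r L.
Proof.
move=> r0 r1 L0; rewrite !fcurrent_flux //.
have [p0 p1 _] := fstationary_distP L.+1 r0; have [q0 q1 _] := fstationary_distP L r0.
apply: (flux_le_of_stationary r0 r1 L0 p0 p1 q0 q1) => f lf.
  rewrite -[RHS](@fstationary_local L.+1 f r0) //.
    by apply: eq_bigr => eta _; rewrite generator_succ.
  by move=> eta zeta ez; apply: lf => k wk; apply: ez; move: wk; rewrite /in_window; lia.
exact: fstationary_local.
Qed.
End FiniteChain.

(** * The infinite system *)

Definition restriction (L : nat) (eta : int -> bool) : fconfig L :=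
  [ffun i => eta (site i)].

Lemma occupied_restriction (R : realType) L (f : (int -> bool) -> R) eta :
  local_on L f -> f (occupied (restriction L eta)) = f eta.
Proof. by move=> lf; apply: local_on_occupied => // i; rewrite ffunE. Qed.

Definition cylinder_set (L : nat) (zeta : fconfig L) : set config :=
  [set eta : config | restriction L eta = zeta]%classic.

Lemma measurable_coordinate (k : int) (b : bool) :
  measurable ([set eta : config | eta k = b]%classic : set config).
Proof. by apply: sub_sigma_algebra; exists k, b. Qed.

Lemma measurable_cylinder_set L (zeta : fconfig L) : measurable (cylinder_set zeta).
Proof.
have -> : cylinder_set zeta =
    (\bigcap_(i in [set: 'I_L.*2]) [set eta : config | eta (site i) = zeta i])%classic.
  apply/seteqP; split => eta /=.
    by move=> <- i _; rewrite /= ffunE.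
  by move=> H; apply/ffunP => i; rewrite ffunE; exact: H.
apply: fin_bigcap_measurable => [|i _]; first exact: finite_finset.
exact: measurable_coordinate.
Qed.

(** * Integration of window functions *)

Section Integration.
Variables (R : realType) (nu : {measure set config -> \bar R}).
Hypothesis nu1 : nu setT = 1%E.

Lemma bounded_integrable (f : config -> R) (c : R) :
  measurable_fun setT f -> (forall eta, `|f eta| <= c) ->
  nu.-integrable setT (EFin \o f).
Proof.
move=> mf fc; apply: measurable_bounded_integrable => //.
  by rewrite nu1 ltry.
exists c; split; first exact: num_real.
by move=> M cM eta _; apply: le_trans (fc eta) (ltW cM).
Qed.

Lemma Rintegral_sum (I : finType) (c : I -> R) (g : I -> config -> R) :
  (forall i, nu.-integrable setT (EFin \o g i)) ->
  nu.-integrable setT (EFin \o (fun eta => \sum_i c i * g i eta)) /\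
  Rintegral nu setT (fun eta => \sum_i c i * g i eta) =
  \sum_i c i * Rintegral nu setT (g i).
Proof.
move=> ig; elim: (index_enum I) => [|i s [IH1 IH2]].
  under [X in EFin \o X]eq_fun do rewrite big_nil.
  under [X in Rintegral _ _ X]eq_fun do rewrite big_nil.
  rewrite big_nil; split; last by rewrite Rintegral_cst // mul0r.
  by apply: (@bounded_integrable (cst 0) 0) => // eta; rewrite normr0.
under [X in EFin \o X]eq_fun do rewrite big_cons.
under [X in Rintegral _ _ X]eq_fun do rewrite big_cons.
have icg : nu.-integrable setT (EFin \o (fun eta => c i * g i eta)).
  exact: (integrableZl measurableT (c i) (ig i)).
rewrite big_cons; split; first exact: (integrableD measurableT icg IH1).
by rewrite RintegralD // IH2 RintegralZl.
Qed.

Lemma Rintegral_total_cst (c : R) : Rintegral nu setT (cst c) = c.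
Proof. by rewrite Rintegral_cst // nu1 mulr1. Qed.

Lemma integrable_fun_indic (A : set config) : measurable A ->
  nu.-integrable setT (EFin \o (\1_A : config -> R)).
Proof.
move=> mA; apply: (@bounded_integrable _ 1) => [|eta]; first exact: measurable_indic.
by rewrite indicE; case: (_ \in _); rewrite ?normr1 ?normr0.
Qed.

Lemma Rintegral_indic (A : set config) : measurable A ->
  Rintegral nu setT (\1_A : config -> R) = fine (nu A).
Proof. by move=> mA; rewrite /Rintegral integral_indic // setIT. Qed.

(** A window function is a finite linear combination of indicators of cylinder sets. *)
Lemma Rintegral_local L (f : (int -> bool) -> R) : local_on L f ->
  nu.-integrable setT (EFin \o (f : config -> R)) /\
  Rintegral nu setT (f : config -> R) =
  \sum_(zeta : fconfig L) f (occupied zeta) * fine (nu (cylinder_set zeta)).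
Proof.
move=> lf.
have fE : (f : config -> R) =
    fun eta => \sum_(zeta : fconfig L) f (occupied zeta) * \1_(cylinder_set zeta) eta.
  apply/funext => eta; rewrite (bigD1 (restriction L eta)) //=.
  rewrite indicE mem_set // mulr1 occupied_restriction // big1 ?addr0 // => z zr.
  by rewrite indicE memNset ?mulr0 // => /= e; rewrite e eqxx in zr.
have [H1 H2] := @Rintegral_sum (fconfig L) (fun z => f (occupied z))
  (fun z => \1_(cylinder_set z)) (fun z => integrable_fun_indic (measurable_cylinder_set z)).
rewrite [X in nu.-integrable _ (EFin \o X)]fE [X in Rintegral _ _ X]fE; split => //.
rewrite H2; apply: eq_bigr => z _.
by rewrite Rintegral_indic //; exact: measurable_cylinder_set.
Qed.

Lemma fine_measure_le1 (A : set config) : measurable A ->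
  nu A \is a fin_num /\ 0 <= fine (nu A) <= 1.
Proof.
move=> mA; have A1 : (nu A <= 1)%E by rewrite -nu1 le_measure ?inE.
have fA : nu A \is a fin_num.
  by rewrite ge0_fin_numE // (le_lt_trans A1) ?ltry.
by split => //; rewrite -!lee_fin fineK // measure_ge0.
Qed.
End Integration.

(** * Stationary measures on Z *)

Section InfiniteSystem.
Variables (R : realType) (r : R).

(** The bonds - L, ..., L read the sites - L, ..., L + 1, which form the window of size L + 1. *)
Lemma bulk_generator_local L (f : (int -> bool) -> R) : local_on L f ->
  local_on L.+1 (bulk_generator r L f).
Proof.
move=> lf eta zeta ez; apply: eq_bigr => j _; have jL := ltn_ord j.
have w0 : in_window L.+1 (bond j) by rewrite /in_window /bond; lia.
have w1 : in_window L.+1 (bond j + 1) by rewrite /in_window /bond; lia.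
have wS k : in_window L k -> in_window L.+1 k by rewrite /in_window; lia.
rewrite (ez _ w0) (ez _ w1); congr (_ * (_ - _)); apply: lf => k /wS /ez e //.
by rewrite !moveE e.
Qed.

Lemma flux_local L : (0 < L)%N -> local_on L (flux r).
Proof.
move=> L0 eta zeta ez; rewrite /flux !ez // /in_window; lia.
Qed.

(** Jumps across bonds outside - L, ..., L do not change f, so the sum over Z is finite. *)
Lemma tasep_generator_local L (f : (int -> bool) -> R) : local_on L f ->
  tasep_generator r f = bulk_generator r L f.
Proof.
move=> lf; apply/funext => eta; rewrite /tasep_generator /bulk_generator.
set F := fun i : int => _.
have bond_inj : injective (@bond L).
  by move=> i j; rewrite /bond => e; apply/val_inj => /=; lia.
transitivity (\sum_(b <- [seq bond j | j <- enum 'I_L.*2.+1]) F b); last first.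
  by rewrite big_map big_enum.
rewrite [RHS]fsbig_seq; last by rewrite (map_inj_uniq bond_inj) enum_uniq.
symmetry; apply: fsbig_widen => // k [_ /= kb].
have kw : ~~ (- L%:Z <= k <= L%:Z).
  apply/negP => kw; apply: kb; apply/mapP.
  have kL : (`|(k + L%:Z)%R|%N < L.*2.+1)%N by lia.
  by exists (Ordinal kL); rewrite ?mem_enum // /bond /=; lia.
rewrite /F -/(move k eta) (move_outside eta lf) ?subrr ?mulr0 //;
  by rewrite /in_window; lia.
Qed.

Lemma local_cylinder L (f : (int -> bool) -> R) : local_on L f -> cylinder f.
Proof.
move=> lf; exists [seq site i | i <- enum 'I_L.*2] => eta zeta ez.
apply: lf => k /in_windowP[i <-]; by apply: ez; rewrite map_f ?mem_enum.
Qed.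

Variables (P : R -> R.-pker config ~> config) (mu : probability config R).
Hypotheses (tP : tasep_process r P) (sP : stationary P mu).

(** The function [kernel_op P t f] is a finite combination of the masses that [P t] gives to
    cylinder sets, and stationarity applies to each. *)
Lemma Rintegral_kernel_op L (f : (int -> bool) -> R) t : 0 <= t -> local_on L f ->
  mu.-integrable setT (EFin \o (kernel_op P t f : config -> R)) /\
  Rintegral mu setT (kernel_op P t f : config -> R) = Rintegral mu setT (f : config -> R).
Proof.
move=> t0 lf; have mu1 : mu setT = 1%E := probability_setT mu.
have fP (A : set config) : measurable A -> forall eta, P t eta A \is a fin_num /\
    0 <= fine (P t eta A) <= 1.
  by move=> mA eta; exact: (@fine_measure_le1 R (P t eta) (prob_kernel eta) A mA).
have E : (kernel_op P t f : config -> R) = fun eta =>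
    \sum_(z : fconfig L) f (occupied z) * fine (P t eta (cylinder_set z)).
  by apply/funext => eta; exact: (@Rintegral_local R (P t eta) (prob_kernel eta) L f lf).2.
have ic (z : fconfig L) :
    mu.-integrable setT (EFin \o (fun eta => fine (P t eta (cylinder_set z)))).
  have mz := measurable_cylinder_set z.
  apply: (bounded_integrable mu1 (c := 1)).
    by apply: measurableT_comp => //; exact: measurable_kernel.
  by move=> eta; have [_ /andP[p0 p1]] := fP _ mz eta; rewrite ger0_norm.
have [H1 H2] := Rintegral_sum mu1 (fun z => f (occupied z)) ic.
rewrite E; split => //; rewrite H2 (Rintegral_local mu1 lf).2.
apply: eq_bigr => z _; congr (_ * _); have mz := measurable_cylinder_set z.
apply: etrans (congr1 fine (sP t0 mz)); congr fine; apply: eq_integral => eta _.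
by rewrite fineK //; have [] := fP _ mz eta.
Qed.

(** By stationarity (P_t f - f) / t has mean zero for t > 0; for some t it is uniformly within e of
    the generator, whose mean is thus at most e in absolute value. *)
Lemma Rintegral_bulk_generator L (f : (int -> bool) -> R) : local_on L f ->
  Rintegral mu setT (bulk_generator r L f : config -> R) = 0.
Proof.
move=> lf; have mu1 : mu setT = 1%E := probability_setT mu.
apply/eqP; rewrite -normr_le0; apply/ler_addgt0Pl => e e0; rewrite addr0.
have [t [t0 /= te]] : exists t, 0 < t /\ forall eta : int -> bool,
    `|(kernel_op P t f eta - f eta) / t - tasep_generator r f eta| < e.
  have := filterI (nbhs_right_gt 0) (tasep_infinitesimal tP (local_cylinder lf) e0).
  by move=> /(_ _) /filter_ex[t [t0 te]]; exists t.
rewrite (tasep_generator_local lf) in te.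
have [iK EK] := Rintegral_kernel_op (ltW t0) lf.
have [iF _] := Rintegral_local mu1 lf.
have [iG _] := Rintegral_local mu1 (bulk_generator_local lf).
have iKF := integrableB measurableT iK iF.
have iKFt := integrableZl measurableT t^-1 iKF.
have iD := integrableB measurableT iKFt iG.
pose D (eta : config) := t^-1 * (kernel_op P t f eta - f eta) - bulk_generator r L f eta.
have ED : Rintegral mu setT D = - Rintegral mu setT (bulk_generator r L f : config -> R).
  rewrite /D RintegralB // RintegralZl // RintegralB // EK subrr mulr0 sub0r //.
rewrite -normrN -ED; apply: (le_trans (le_normr_Rintegral measurableT iD)).
rewrite -[leRHS](Rintegral_total_cst mu1 e); apply: le_Rintegral => //.
- exact: integrable_norm iD.
- exact: (@bounded_integrable _ mu mu1 (cst e) `|e|).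
by move=> eta _; rewrite /D mulrC ltW.
Qed.

Lemma current_flux : current r mu = Rintegral mu setT (flux r : config -> R).
Proof.
have mA : measurable ([set eta : config | eta 0 && ~~ eta 1]%classic : set config).
  have -> : [set eta : config | eta 0 && ~~ eta 1]%classic =
     ([set eta : config | eta 0 = true] `&` [set eta : config | eta 1 = false])%classic.
    by apply/seteqP; split => eta /=; [move=> /andP[-> /negbTE]|move=> [-> ->]].
  by apply: measurableI; exact: measurable_coordinate.
have mu1 : mu setT = 1%E := probability_setT mu.
rewrite /current -Rintegral_indic // -RintegralZl //; last exact: integrable_fun_indic.
congr Rintegral; apply/funext => eta; congr (_ * (nat_of_bool _)%:R).
by apply/idP/idP => [/set_mem|/mem_set].
Qed.

Lemma current_le_fcurrent L : 0 <= r -> r <= 1 -> (0 < L)%N ->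
  current r mu <= fcurrent r L.
Proof.
move=> r0 r1 L0; have mu1 : mu setT = 1%E := probability_setT mu.
(* The marginal of [mu] is taken on the window of size L + 1, because [bulk_generator] at size L
   also reads the sites - L and L + 1. *)
pose p (z : fconfig L.+1) := fine (mu (cylinder_set z)).
have pE (f : (int -> bool) -> R) : local_on L.+1 f ->
    \sum_z p z * f (occupied z) = Rintegral mu setT (f : config -> R).
  move=> lf; rewrite (Rintegral_local mu1 lf).2.
  by apply: eq_bigr => z _; rewrite mulrC.
rewrite current_flux fcurrent_flux // -pE; last exact: flux_local.
have [q0 q1 _] := fstationary_distP L r0.
apply: (flux_le_of_stationary r0 r1 L0 _ _ q0 q1) => [z||f lf|f lf].
- by rewrite /p fine_ge0.
- have := pE (fun=> 1) (fun _ _ _ => erefl).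
  rewrite (Rintegral_total_cst mu1) => <-.
  by apply: eq_bigr => z _; rewrite mulr1.
- by rewrite pE ?Rintegral_bulk_generator //; exact: bulk_generator_local.
- exact: fstationary_local.
Qed.
End InfiniteSystem.

Theorem mainTheorem4 (R : realType) (r : R) (hr0 : 0 <= r) (hr1 : r <= 1) :
  (forall L : nat, (1 <= L)%N -> fcurrent r L.+1 <= fcurrent r L)
  /\ (forall P : R -> R.-pker config ~> config, tasep_process r P ->
      forall L : nat, (1 <= L)%N ->
      forall mu : probability config R, stationary P mu ->
        current r mu <= fcurrent r L)
  /\ (forall P : R -> R.-pker config ~> config, tasep_process r P ->
      forall L : nat, (1 <= L)%N -> fcurrent r L < 1 / 4 ->
      ~ (exists mu : probability config R,
           stationary P mu /\ fcurrent r L < current r mu <= 1 / 4)).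
Proof.
have bound P : tasep_process r P -> forall L, (1 <= L)%N ->
    forall mu : probability config R, stationary P mu -> current r mu <= fcurrent r L.
  by move=> tP L L0 mu sP; exact: (current_le_fcurrent tP sP).
split; first by move=> L; exact: fcurrent_succ.
split=> [//|P tP L L0 _ [mu [sP /andP[lt_J _]]]].
by move: lt_J; rewrite ltNge (bound P tP).
Qed.
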